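(* Let $n,l$ be nonnegative integers, $\mathbf m=(m_1,\dots,m_n)\in\mathbb Z^n$ and $\mathbf k=(k_1,\dots,k_l)\in\mathbb Z^l$, and write $x_{\mathbf m}=x^-_{m_1}\cdots x^-_{m_n}$ and $x_{\mathbf k}=x^-_{k_1}\cdots x^-_{k_l}$ in $\mathcal N_q^-$. If $n>l$, then $(x_{\mathbf m},x_{\mathbf k})=0$. If $n=l$, $m_1\ge m_2\ge\cdots\ge m_n$, $k_1\ge k_2\ge\cdots\ge k_n$ and $\sum_{i=1}^n m_i=\sum_{i=1}^n k_i$, then $$(x_{\mathbf m},x_{\mathbf k})\equiv\delta_{\mathbf m,\mathbf k}\mod q^2\mathbb Z[\![q]\!],$$ that is, $(x_{\mathbf m},x_{\mathbf k})-\delta_{\mathbf m,\mathbf k}\in q^2\mathbb Z[\![q]\!]$. Moreover, the form $(\ ,\ )$ is symmetric.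
   Context: Let $\mathbb F$ be a field of characteristic zero and $q$ an indeterminate. Let $\mathcal N_q^-$ be the associative unital $\mathbb F(q^{1/2})$-algebra generated by $x_n^-$ ($n\in\mathbb Z$) with relations $$x^-_{k+1}x^-_l-q^{-2}x^-_lx^-_{k+1}=q^{-2}x^-_kx^-_{l+1}-x^-_{l+1}x^-_k\qquad(k,l\in\mathbb Z).$$ (This is the subalgebra of $U_q(\widehat{\mathfrak{sl}(2)})$, in Drinfeld's realization, generated by the $x_n^-$ and the central elements $\gamma^{\pm1/2}$, with $\gamma^{1/2}$ set equal to $1$.) The ordered monomials $x^-_{i_1}\cdots x^-_{i_k}$ with $k\ge0$, $i_1\ge\cdots\ge i_k$, form an $\mathbb F(q^{1/2})$-basis of $\mathcal N_q^-$. Let $g_{q^{-1}}(t)=\sum_{r\ge0}g_{q^{-1}}(r)t^r$ be the Taylor series at $t=0$ of $(q^{-2}t-1)/(t-q^{-2})$; explicitly $g_{q^{-1}}(0)=q^2$ and $g_{q^{-1}}(r)=(q^4-1)q^{2(r-1)}$ for $r>0$. The operators $\Omega_\psi(k):\mathcal N_q^-\to\mathcal N_q^-$, $k\in\mathbb Z$, are the $\mathbb F(q^{1/2})$-linear operators given by the generating function $\Omega_\psi(u)=\sum_k\Omega_\psi(k)u^{-k}$ through $$\Omega_\psi(u)\big(x^-(v_1)\cdots x^-(v_k)\big)=\sum_{l=1}^k\ \prod_{j=1}^{l-1}g_{q^{-1}}(v_j/v_l)\ x^-(v_1)\cdots x^-(v_{l-1})x^-(v_{l+1})\cdots x^-(v_k)\,\delta(u/v_l),$$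 where $x^-(v)=\sum_m x^-_mv^{-m}$ and $\delta(z)=\sum_{k\in\mathbb Z}z^k$. Equivalently, $\Omega_\psi(k)(1)=0$ and $$\Omega_\psi(k)(x^-_ma)=\delta_{k,-m}a+\sum_{r\ge0}g_{q^{-1}}(r)\,x^-_{m+r}\,\Omega_\psi(k-r)(a)\qquad(a\in\mathcal N_q^-),$$ where the sum is finite because $\Omega_\psi(k-r)(a)=0$ for $r$ large. It is known that there is a unique symmetric $\mathbb F(q^{1/2})$-bilinear form $(\ ,\ ):\mathcal N_q^-\times\mathcal N_q^-\to\mathbb F(q^{1/2})$ satisfying $(1,1)=1$ and $(x_m^-a,b)=(a,\Omega_\psi(-m)b)$ for all $m\in\mathbb Z$ and $a,b\in\mathcal N_q^-$; this is the form $(\ ,\ )$. Rational functions of $q$ regular at $0$ are identified with their power series expansions at $q=0$. *)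

(* Defs.v *)
(* Mathematical Components, with the monoid algebras {malg R[M]} of the
   multinomials library. *)
From HB Require Import structures.
From mathcomp Require Import all_boot all_order all_algebra.
From mathcomp Require Import monalg.
From Stdlib Require Import ClassicalEpsilon.

Set Implicit Arguments.
Unset Strict Implicit.
Unset Printing Implicit Defensive.

Import Order.TTheory GRing.Theory Num.Theory.
Local Open Scope ring_scope.
Local Open Scope quotient_scope.

Section BaseField.
Variable F : fieldType.

(* The variable of {poly F} plays the role of q^{1/2}. *)
Definition Kq : fieldType := {fraction {poly F}}.

Local Notation "p %:F" := (@FracField.tofrac _ p).

Definition qhalf : Kq := ('X : {poly F})%:F.
Definition qq : Kq := qhalf ^+ 2.

Lemma qhalf_neq0 : qhalf != 0.
Proof. by rewrite /qhalf tofrac_eq0 polyX_eq0. Qed.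

Lemma qq_neq0 : qq != 0.
Proof. by rewrite expf_neq0 // qhalf_neq0. Qed.

Definition poly_in_q (p : {poly F}) : Kq := (p \Po 'X^2)%:F.

(* [f] is a rational function of q, regular at q = 0, whose expansion at q = 0
   is \sum_i c i * q^i: with f = p(q) / d(q) and d(0) != 0, the Cauchy product of
   c with d is p. *)
Definition q_expansion (f : Kq) (c : nat -> F) : Prop :=
  exists p d : {poly F},
    [/\ d`_0 != 0, f = poly_in_q p / poly_in_q d
      & forall i, p`_i = \sum_(j < i.+1) c j * d`_(i - j)].

(* The ideal q^2 Z[[q]] of Z[[q]]. *)
Definition in_q2Zq (f : Kq) : Prop :=
  exists c : nat -> int,
    [/\ c 0%N = 0, c 1%N = 0 & q_expansion f (fun i => (c i)%:~R)].

End BaseField.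

(* The quotient of an algebra by the two-sided ideal generated by the elements
   satisfying [rel]. *)
Section QuotientAlgebra.
Variables (K : fieldType) (A : algType K) (rel : A -> Prop).

(* Stable under scalars and opposites since c *: a = c%:A * a. *)
Inductive in_ideal : A -> Prop :=
| in_ideal_gen a : rel a -> in_ideal a
| in_ideal0 : in_ideal 0
| in_idealD a b : in_ideal a -> in_ideal b -> in_ideal (a + b)
| in_idealMl a b : in_ideal b -> in_ideal (a * b)
| in_idealMr a b : in_ideal a -> in_ideal (a * b).

Definition ideal_pred : {pred A} :=
  fun a => if excluded_middle_informative (in_ideal a) then true else false.

Lemma ideal_predP a : reflect (in_ideal a) (a \in ideal_pred).
Proof.
by rewrite unfold_in /ideal_pred; case: excluded_middle_informative; constructor.
Qed.

Lemma in_idealN a : in_ideal a -> in_ideal (- a).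
Proof. by rewrite -mulN1r; apply: in_idealMl. Qed.

Lemma ideal_pred_zmod_closed : zmod_closed ideal_pred.
Proof.
split=> [|a b /ideal_predP Ha /ideal_predP Hb]; apply/ideal_predP.
  exact: in_ideal0.
by apply: in_idealD => //; apply: in_idealN.
Qed.

HB.instance Definition _ :=
  GRing.isZmodClosed.Build A ideal_pred ideal_pred_zmod_closed.

Hypothesis rel_proper : ~ in_ideal 1.

(* The dependency on rel_proper lets the instances below find it. *)
Definition quoAlg : Type := let _ := rel_proper in {ideal_quot ideal_pred}.
HB.instance Definition _ : GRing.Zmodule quoAlg :=
  GRing.Zmodule.on {ideal_quot ideal_pred}.

(* Locked, to keep the representatives out of unification. *)
Definition piQ : A -> quoAlg := locked \pi_{ideal_quot ideal_pred}.
Definition reprQ : quoAlg -> A := locked repr.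

Lemma reprQK : cancel reprQ piQ.
Proof. by rewrite /piQ /reprQ; unlock => a; apply: reprK. Qed.

Lemma piQ_eqP a b : piQ a = piQ b <-> in_ideal (a - b).
Proof.
rewrite /piQ; unlock; split=> [/eqP|/ideal_predP ab].
  by rewrite -Quotient.idealrBE => /ideal_predP.
by apply/eqP; rewrite -Quotient.idealrBE.
Qed.

Lemma piQ_repr a : in_ideal (reprQ (piQ a) - a).
Proof. by apply/piQ_eqP; rewrite reprQK. Qed.

Fact piQ_is_zmod_morphism : zmod_morphism piQ.
Proof. by rewrite /piQ; unlock => a b; rewrite raddfB. Qed.
HB.instance Definition _ :=
  GRing.isZmodMorphism.Build A quoAlg piQ piQ_is_zmod_morphism.

Definition quo_one : quoAlg := piQ 1.
Definition quo_mul (a b : quoAlg) : quoAlg := piQ (reprQ a * reprQ b).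
Definition quo_scale (c : K) (a : quoAlg) : quoAlg := piQ (c *: reprQ a).

Lemma piQ_mul a b : piQ (a * b) = quo_mul (piQ a) (piQ b).
Proof.
apply/esym/piQ_eqP; set a' := reprQ _; set b' := reprQ _.
have -> : a' * b' - a * b = (a' - a) * b' + a * (b' - b).
  by rewrite mulrBl mulrBr addrA subrK.
by apply: in_idealD; [apply: in_idealMr | apply: in_idealMl];
  apply: piQ_repr.
Qed.

Lemma piQ_scale c a : piQ (c *: a) = quo_scale c (piQ a).
Proof.
apply/esym/piQ_eqP; rewrite -scalerBr -mulr_algl.
exact/in_idealMl/piQ_repr.
Qed.

Lemma quo_surj (a : quoAlg) : {b | a = piQ b}.
Proof. by exists (reprQ a); rewrite reprQK. Qed.

Fact quo_mulA : associative quo_mul.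
Proof.
move=> a b c.
have [a' ->] := quo_surj a; have [b' ->] := quo_surj b; have [c' ->] := quo_surj c.
by rewrite -!piQ_mul mulrA.
Qed.

Fact quo_mul1 : left_id quo_one quo_mul.
Proof. by move=> a; have [b ->] := quo_surj a; rewrite -piQ_mul mul1r. Qed.

Fact quo_mulr1 : right_id quo_one quo_mul.
Proof. by move=> a; have [b ->] := quo_surj a; rewrite -piQ_mul mulr1. Qed.

Fact quo_mulDl : left_distributive quo_mul +%R.
Proof.
move=> a b c.
have [a' ->] := quo_surj a; have [b' ->] := quo_surj b; have [c' ->] := quo_surj c.
by rewrite -raddfD -!piQ_mul mulrDl raddfD.
Qed.

Fact quo_mulDr : right_distributive quo_mul +%R.
Proof.
move=> a b c.
have [a' ->] := quo_surj a; have [b' ->] := quo_surj b; have [c' ->] := quo_surj c.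
by rewrite -raddfD -!piQ_mul mulrDr raddfD.
Qed.

Fact quo_one_neq0 : quo_one != 0.
Proof.
apply/eqP; rewrite -(raddf0 piQ) => /piQ_eqP; rewrite subr0.
exact: rel_proper.
Qed.

HB.instance Definition _ := GRing.Zmodule_isNzRing.Build quoAlg
  quo_mulA quo_mul1 quo_mulr1 quo_mulDl quo_mulDr quo_one_neq0.

Fact quo_scaleA c d a : quo_scale c (quo_scale d a) = quo_scale (c * d) a.
Proof. by have [b ->] := quo_surj a; rewrite -!piQ_scale scalerA. Qed.

Fact quo_scale1 : left_id 1 quo_scale.
Proof. by move=> a; have [b ->] := quo_surj a; rewrite -piQ_scale scale1r. Qed.

Fact quo_scaleDr : right_distributive quo_scale +%R.
Proof.
move=> c a b; have [a' ->] := quo_surj a; have [b' ->] := quo_surj b.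
by rewrite -raddfD -!piQ_scale scalerDr raddfD.
Qed.

Fact quo_scaleDl a : {morph quo_scale^~ a : c d / c + d}.
Proof.
by move=> c d; have [b ->] := quo_surj a; rewrite -!piQ_scale scalerDl raddfD.
Qed.

HB.instance Definition _ := GRing.Zmodule_isLmodule.Build K quoAlg
  quo_scaleA quo_scale1 quo_scaleDr quo_scaleDl.

Fact quo_scaleAl c (a b : quoAlg) : c *: (a * b) = (c *: a) * b.
Proof.
have [a' ->] := quo_surj a; have [b' ->] := quo_surj b.
change (quo_scale c (quo_mul (piQ a') (piQ b'))
        = quo_mul (quo_scale c (piQ a')) (piQ b')).
by rewrite -piQ_mul -!piQ_scale -piQ_mul scalerAl.
Qed.

HB.instance Definition _ := GRing.Lmodule_isLalgebra.Build K quoAlg quo_scaleAl.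

Fact quo_scaleAr c (a b : quoAlg) : c *: (a * b) = a * (c *: b).
Proof.
have [a' ->] := quo_surj a; have [b' ->] := quo_surj b.
change (quo_scale c (quo_mul (piQ a') (piQ b'))
        = quo_mul (piQ a') (quo_scale c (piQ b'))).
by rewrite -piQ_mul -!piQ_scale -piQ_mul scalerAr.
Qed.

HB.instance Definition _ := GRing.Lalgebra_isAlgebra.Build K quoAlg quo_scaleAr.

Fact piQ_is_monoid_morphism : monoid_morphism piQ.
Proof. by split; [exact: erefl | exact: piQ_mul]. Qed.
HB.instance Definition _ :=
  GRing.isMonoidMorphism.Build A quoAlg piQ piQ_is_monoid_morphism.

Fact piQ_is_scalable : scalable piQ.
Proof. exact: piQ_scale. Qed.
HB.instance Definition _ :=
  GRing.isScalable.Build K A quoAlg *:%R piQ piQ_is_scalable.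

End QuotientAlgebra.

(* The free algebra on the symbols x_n, n : int. *)
Section FreeAlgebra.
Variable K : fieldType.

Definition freeA := {malg K[{fmonom int}]}.
HB.instance Definition _ := GRing.Lalgebra.on freeA.

Fact freeA_scalerAr c (a b : freeA) : c *: (a * b) = a * (c *: b).
Proof.
have malgC_comm (g : {malg K[{fmonom int}]}) : g * c%:MP = c%:MP * g.
  rewrite mul_malgC malgM_def malgZ_def fgmulgU.
  by apply: eq_bigr => k _; rewrite mulm1 mulrC.
by rewrite -!mul_malgC !mulrA malgC_comm.
Qed.
HB.instance Definition _ := GRing.Lalgebra_isAlgebra.Build K freeA freeA_scalerAr.

Definition freex (n : int) : freeA := << fmu n >>.

(* The coefficient of the empty word. *)
Definition freeA_coef1 (a : freeA) : K := mcoeff mone (a : {malg K[{fmonom int}]}).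

Lemma freeA_coef1_freex n : freeA_coef1 (freex n) = 0.
Proof. by rewrite /freeA_coef1 mcoeffU fmP fmuE fm1. Qed.

Fact freeA_coef1_is_zmod_morphism : zmod_morphism freeA_coef1.
Proof. by move=> a b; apply: mcoeffB. Qed.
HB.instance Definition _ := GRing.isZmodMorphism.Build freeA K freeA_coef1
  freeA_coef1_is_zmod_morphism.

Fact freeA_coef1_is_monoid_morphism : monoid_morphism freeA_coef1.
Proof.
have [M U] := @mcoeff1g_is_multiplicative {fmonom int} K.
by split; [exact: U | exact: M].
Qed.
HB.instance Definition _ := GRing.isMonoidMorphism.Build freeA K freeA_coef1
  freeA_coef1_is_monoid_morphism.

Fact freeA_coef1_is_scalable : scalable_for *%R freeA_coef1.
Proof. by move=> c a; apply: mcoeffZ. Qed.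
HB.instance Definition _ := GRing.isScalable.Build K freeA K *%R freeA_coef1
  freeA_coef1_is_scalable.

End FreeAlgebra.

Section Nq.
Variables (K : fieldType) (q : K).

Definition gq (r : nat) : K :=
  if r is s.+1 then (q ^+ 4 - 1) * q ^+ (2 * s) else q ^+ 2.

(* (t - q^{-2}) * (\sum_r gq r * t^r) = q^{-2} t - 1, coefficient by coefficient. *)
Lemma gq_taylor (r : nat) : q != 0 ->
  (if r is s.+1 then gq s else 0) - q ^- 2 * gq r
  = q ^- 2 * (r == 1)%:R - (r == 0)%:R.
Proof.
move=> q0.
have q20 : q ^+ 2 != 0 by rewrite expf_neq0.
have E4 : q ^+ 4 = q ^+ 2 * q ^+ 2 by rewrite -exprD.
case: r => [|[|r]] /=.
- by rewrite mulVf // mulr0.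
- rewrite muln0 expr0 !mulr1 subr0 mulrBr mulr1 E4 mulKf //.
  by rewrite opprB addrCA subrr addr0.
- rewrite mulr0 subr0 mulnS exprD.
  by rewrite [_ ^- 2 * _]mulrC mulrA mulrAC mulfK // subrr.
Qed.

Definition relator (A : algType K) (x : int -> A) (k l : int) : A :=
  (x (k + 1) * x l - q ^- 2 *: (x l * x (k + 1)))
  - (q ^- 2 *: (x k * x (l + 1)) - x (l + 1) * x k).

Lemma relator_morph (A B : algType K) (f : {lrmorphism A -> B}) x k l :
  f (relator x k l) = relator (f \o x) k l.
Proof. by rewrite /relator !raddfB /= !linearZ /= !rmorphM. Qed.

Lemma relator0 (A : algType K) (x : int -> A) k l :
  (forall n, x n = 0) -> relator x k l = 0.
Proof. by move=> x0; rewrite /relator !x0 !mul0r !scaler0 !subr0. Qed.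

Definition Nq_rel (a : freeA K) : Prop := exists k l, a = relator (freex K) k l.

Lemma Nq_proper : ~ in_ideal Nq_rel 1.
Proof.
pose f : {lrmorphism freeA K -> K^o} := @freeA_coef1 K.
have aug a : in_ideal Nq_rel a -> f a = 0.
  elim=> {a} [_ [k [l ->]]||a b _ a0 _ b0|a b _ b0|a b _ a0].
  - by rewrite relator_morph; apply: relator0 => n; apply: freeA_coef1_freex.
  - exact: raddf0.
  - by rewrite raddfD /= a0 b0 addr0.
  - by rewrite rmorphM /= b0 mulr0.
  - by rewrite rmorphM /= a0 mul0r.
by move=> /aug /eqP; rewrite rmorph1 oner_eq0.
Qed.

Definition Nq : Type := quoAlg Nq_proper.
HB.instance Definition _ := GRing.Algebra.on Nq.

Definition xm (n : int) : Nq := piQ Nq_proper (freex K n).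

Lemma xm_relation (k l : int) :
  xm (k + 1) * xm l - q ^- 2 *: (xm l * xm (k + 1))
  = q ^- 2 *: (xm k * xm (l + 1)) - xm (l + 1) * xm k.
Proof.
apply/eqP; rewrite -subr_eq0; apply/eqP.
transitivity (piQ Nq_proper (relator (freex K) k l)).
  by rewrite relator_morph.
rewrite -(raddf0 (piQ Nq_proper)); apply/piQ_eqP; rewrite subr0.
by apply: in_ideal_gen; exists k, l.
Qed.

Definition xmon (s : seq int) : Nq := \prod_(i <- s) xm i.

Record is_Omega_psi (Om : int -> Nq -> Nq) : Prop := {
  Omega_psi_linear k : linear (Om k);
  Omega_psi1 k : Om k 1 = 0;
  Omega_psi_vanish k a :
    exists R : nat, forall r : nat, (R <= r)%N -> Om (k - r%:Z) a = 0;
  Omega_psiM k m a (R : nat) :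
    (forall r : nat, (R <= r)%N -> Om (k - r%:Z) a = 0) ->
    Om k (xm m * a)
    = (k == - m)%:R *: a
      + \sum_(r < R) gq r *: (xm (m + r%:Z) * Om (k - r%:Z) a)
}.

(* The family satisfying is_Omega_psi; it is unique because the monomials
   span Nq. *)
Definition Omega_psi : int -> Nq -> Nq :=
  epsilon (inhabits (fun _ _ => 0)) is_Omega_psi.

Record is_Nq_form (B : Nq -> Nq -> K) : Prop := {
  Nq_form_linearl b : scalar (B^~ b);
  Nq_form_linearr a : scalar (B a);
  Nq_form_sym a b : B a b = B b a;
  Nq_form11 : B 1 1 = 1;
  Nq_form_adj m a b : B (xm m * a) b = B a (Omega_psi (- m) b)
}.

(* Unique as well: (x_m a, b) = (a, Omega_psi(-m) b) reduces a form to (1, b),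
   and symmetry gives (1, x_k b) = (b, Omega_psi(-k) 1) = 0. *)
Definition Nq_form : Nq -> Nq -> K :=
  epsilon (inhabits (fun _ _ => 0)) is_Nq_form.

End Nq.

(* Main.v *)
From HB Require Import structures.
Require Import Defs.
From mathcomp Require Import all_boot all_order all_algebra.
From mathcomp Require Import finmap monalg.
From mathcomp Require Import zify ring.
From Stdlib Require Import ClassicalEpsilon.

(** Write D_m = Omega_psi(-m), so that
      D_m (x_k a) = [m = k] a + sum_r g(r) x_(k+r) D_(m+r) (a),
    and (x_m a, b) = (a, D_m b).

    Integrality.  All g(r) lie in Z[q], so D_m sends a monomial of length d + 1
    to a Z[q]-combination of monomials of length d, and kills 1.  Peeling off
    the letters of x_m with the adjunction, the number (x_m, x_k) is 0 when x_m
    is longer than x_k (form_shorter_eq0) and lies in Z[q] when the lengths agree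
    (form_int).

    Congruence (form_word_triangular).  The index of D only grows along the
    recursion, so D_m kills every monomial whose letters have indices below m.
    Compare the heads of two non-increasing words of equal length.  If they
    differ, the larger head may be taken in the left argument because the form
    is symmetric, and the pairing is 0.  If both are k, then
    D_k (x_k a) = a + g(0) x_k D_k (a), since D_(k+r) (a) = 0 for r > 0; as
    g(0) = q^2, induction on the length leaves the Kronecker delta modulo
    q^2 Z[q].

    The operators and the form are specified by choice, so both have to be
    constructed before their defining properties can be used.  The operators D_m
    are defined by the recursion above on the free algebra.  They preserve the
    ideal of the relations (twder_ideal): on a relator times c, the terms in
    which both letters survive recombine into relators, and the coefficient of
    the terms in which one letter is removed vanishes because
    (t - q^-2) g(t) = q^-2 t - 1 (gz_taylor).  The form is defined on words by
    iterating the adjunction, ending with the augmentation.  Removing a letter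
    on the right is adjoint to D as well (pair_mulr): expanding both
    (x_m a, x_k b) and (D_k (x_m a), b) gives
      [m = k] (a, b) + sum_r g(r) (D_(k+r) a, D_(m+r) b).
    Hence the form is symmetric, and since it kills the ideal on the right, it
    descends to the quotient. *)

Set Implicit Arguments.
Unset Strict Implicit.
Unset Printing Implicit Defensive.

Import Order.TTheory GRing.Theory Num.Theory.
Local Open Scope ring_scope.

(** * Two identities *)

(** Two truncations of the same series agree once both bounds are past its
    support. *)
Lemma sum_trunc (V : zmodType) (f : nat -> V) (R R' : nat) :
  (forall r, (R <= r)%N -> f r = 0) -> (forall r, (R' <= r)%N -> f r = 0) ->
  \sum_(r < R) f r = \sum_(r < R') f r.
Proof.
wlog le : R R' / (R <= R')%N.
  by move=> W h h'; case/orP: (leq_total R R') => le; [|apply/esym]; apply: W.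
move=> h _; rewrite -!(big_mkord predT) (@big_cat_nat _ _ _ R 0 R') //=.
rewrite [X in _ + X]big_nat_cond [X in _ + X]big1 ?addr0 // => r.
by case/andP => /andP[/h].
Qed.

(** Separates the multiples of y from the rest in a combination with the signs
    of the relator. *)
Lemma four_term_comb (K : fieldType) (V : lmodType K) (u c1 c2 c3 c4 : K)
    (y t1 t2 t3 t4 : V) :
  c1 - u * c2 - (u * c3 - c4) = 0 -> t1 - u *: t2 - (u *: t3 - t4) = 0 ->
  c1 *: y + t1 - u *: (c2 *: y + t2) - (u *: (c3 *: y + t3) - (c4 *: y + t4)) = 0.
Proof.
move=> c0 t0.
have subDD (a b c d : V) : a + b - (c + d) = a - c + (b - d).
  by rewrite opprD addrACA.
rewrite !scalerDr [X in X - _]subDD [X in _ - X]subDD subDD t0 addr0.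
by rewrite !scalerA -!scalerBl c0 scale0r.
Qed.

(** * Words in an algebra *)

Definition word (K : fieldType) (A : algType K) (x : int -> A) s : A :=
  \prod_(i <- s) x i.

(** The words form a basis of A, stated as an induction principle (they span)
    and a linear extension (they are independent).  Stated over an abstract
    algebra, it keeps the monoid algebra out of the computations. *)
Record word_basis (K : fieldType) (A : algType K) (x : int -> A) := {
  word_ind (P : A -> Prop) :
    P 0 -> (forall z s a, P a -> P (z *: word x s + a)) -> forall a, P a;
  word_ext (V : lmodType K) (h : seq int -> V) : {linear A -> V};
  word_extE (V : lmodType K) (h : seq int -> V) s : word_ext h (word x s) = h s
}.

Section Word.
Variables (K : fieldType) (A : algType K) (x : int -> A).

Lemma word_cons k s : word x (k :: s) = x k * word x s.
Proof. by rewrite /word big_cons. Qed.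

Lemma word_nil : word x [::] = 1.
Proof. by rewrite /word big_nil. Qed.

End Word.

(** * The words of the free algebra *)

Section FreeWords.
Variable K : fieldType.
Implicit Types (a b c : freeA K) (s : seq int).

Local Notation word := (word (freex K)).

Lemma wordE (w : {fmonom int}) : << w >> = word w :> freeA K.
Proof.
case: w => s; elim: s => [|k s IH].
  by rewrite word_nil -fmoneE.
rewrite word_cons -IH /freex.
have -> : FMonom (k :: s) = mmul (fmu k) (FMonom s) :> {fmonom int}.
  by apply/eqP; rewrite fmP fmM fmuE.
apply: esym; transitivity (fgmul << fmu k >> << FMonom s >> : {malg K[_]}).
  exact: malgM_def.
by rewrite fgmulUU mulr1.
Qed.

Lemma free_ind (P : freeA K -> Prop) :
  P 0 -> (forall z s a, P a -> P (z *: word s + a)) -> forall a, P a.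
Proof.
move=> P0 PD a; rewrite (monalgE a).
elim: (X in \sum_(k <- X) _) => [|k t IH]; first by rewrite big_nil.
rewrite big_cons.
have -> : << a@_k *g k >> = a@_k *: << k >> :> {malg K[{fmonom int}]}.
  by apply/malgP => w; rewrite mcoeffZ !mcoeffU mulrnAr mulr1.
rewrite (wordE k); exact: PD.
Qed.

Section LinExt.
Variables (V : lmodType K) (h : seq int -> V).

Definition lin_ext a : V :=
  \sum_(w <- msupp (a : {malg K[{fmonom int}]})) mcoeff w a *: h w.

Lemma lin_extEw (d : {fset {fmonom int}}) (a : {malg K[{fmonom int}]}) :
  (msupp a `<=` d)%fset -> lin_ext a = \sum_(w <- d) a@_w *: h w.
Proof.
move=> le; rewrite /lin_ext; apply: big_fset_incl => // w _ /mcoeff_outdom ->.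
by rewrite scale0r.
Qed.

Fact lin_ext_is_linear : linear lin_ext.
Proof.
move=> z a b; pose d := (msupp (a : {malg K[{fmonom int}]})
   `|` msupp (b : {malg K[{fmonom int}]})
   `|` msupp (z *: a + b : {malg K[{fmonom int}]}))%fset.
rewrite !(@lin_extEw d) ?fsubsetUr //.
- rewrite scaler_sumr -big_split; apply: eq_bigr => w _ /=.
  by rewrite mcoeffD mcoeffZ scalerDl scalerA.
- by apply: fsubset_trans (fsubsetUl _ _); apply: fsubsetUr.
- by apply: fsubset_trans (fsubsetUl _ _); apply: fsubsetUl.
Qed.
HB.instance Definition _ :=
  GRing.isLinear.Build K (freeA K) V *:%R lin_ext lin_ext_is_linear.

Lemma lin_ext_word s : lin_ext (word s) = h s.
Proof.
rewrite -(wordE (FMonom s)) /lin_ext msuppU1.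
by rewrite big_seq_fset1 mcoeffU1 eqxx scale1r.
Qed.

End LinExt.

Definition freeA_word_basis : word_basis (freex K) :=
  Build_word_basis free_ind lin_ext_word.

End FreeWords.

(** * The operators on the free algebra *)

Section TwistedDerivation.
Variables (K : fieldType) (q : K) (A : algType K) (x : int -> A).
Hypothesis freeX : word_basis x.
Implicit Types (a b : A) (s : seq int) (k l m : int).
Local Notation g := (gq q).

(** The sum over r is infinite in the formula for D_m; it is cut at a bound
    after which m + r exceeds every letter of the word. *)
Fixpoint twder_word s m : A :=
  if s is k :: s' then
    (m == k)%:R *: word x s'
    + \sum_(r < (absz m + \sum_(i <- s') absz i).+1)
        g r *: (x (k + r%:Z) * twder_word s' (m + r%:Z))
  else 0.

Definition twder m : {linear A -> A} := word_ext freeX (twder_word^~ m).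

Lemma twder_wordE m s : twder m (word x s) = twder_word s m.
Proof. exact: word_extE. Qed.

Lemma twder1 m : twder m 1 = 0.
Proof. by rewrite -(word_nil x) twder_wordE. Qed.

(** The index grows along the recursion, so it never meets a letter. *)
Lemma twder_word_vanish s m : (forall i, i \in s -> i < m) -> twder_word s m = 0.
Proof.
elim: s m => //= k s IH m lt.
have /lt_eqF := lt k (mem_head k s); rewrite eq_sym => ->.
rewrite scale0r add0r big1 // => r _; rewrite IH ?mulr0 ?scaler0 // => i si.
have := lt i; rewrite inE si orbT => /(_ isT); lia.
Qed.

Lemma mem_le_sum_abs s i : i \in s -> i <= (\sum_(j <- s) absz j)%N%:Z.
Proof.
elim: s => //= k s IH; rewrite inE big_cons => /orP[/eqP->|/IH]; lia.
Qed.

Lemma twder_vanish a : exists R : nat, forall m, R%:Z <= m -> twder m a = 0.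
Proof.
elim/(word_ind freeX): a => [|z s a [R IH]]; first by exists 0%N => m _; rewrite linear0.
exists (R + (\sum_(j <- s) absz j).+1)%N => m le.
rewrite linearP /= IH; last by lia.
rewrite twder_wordE twder_word_vanish ?scaler0 ?addr0 // => i /mem_le_sum_abs; lia.
Qed.

Lemma twder_vanish_shift m a :
  exists R : nat, forall r : nat, (R <= r)%N -> twder (m + r%:Z) a = 0.
Proof.
have [R v] := twder_vanish a; exists (R + absz m)%N => r le.
by apply: v; lia.
Qed.

(** A bound that annihilates a need not annihilate each word of a, so the formula
    is first shown for all large bounds, a form that is stable under linear
    combinations. *)
Lemma twderM_large m k a : exists R0, forall R, (R0 <= R)%N ->
  twder m (x k * a)
  = (m == k)%:R *: a + \sum_(r < R) g r *: (x (k + r%:Z) * twder (m + r%:Z) a).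
Proof.
elim/(word_ind freeX): a => [|z s a [R0 IH]].
  exists 0%N => R _; rewrite mulr0 linear0 scaler0 add0r big1 // => r _.
  by rewrite linear0 mulr0 scaler0.
set N := (absz m + \sum_(i <- s) absz i).+1.
exists (R0 + N)%N => R le; rewrite mulrDr -scalerAr -word_cons linearP /=.
rewrite (IH R) ?twder_wordE /=; last by lia.
rewrite (@sum_trunc _ (fun r => g r *: (x (k + r%:Z) * twder_word s (m + r%:Z)))
  _ R); first last.
- move=> r ler; rewrite twder_word_vanish ?mulr0 ?scaler0 // => i.
  move/mem_le_sum_abs; rewrite /N in le; lia.
- move=> r ler; rewrite twder_word_vanish ?mulr0 ?scaler0 // => i.
  move/mem_le_sum_abs; lia.
rewrite !scalerDr addrACA !scalerA [z * (m == k)%:R]mulrC; congr (_ + _).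
rewrite scaler_sumr -big_split; apply: eq_bigr => r _ /=.
rewrite linearP /= twder_wordE mulrDr scalerDr -scalerAr.
by rewrite !scalerA [z * _]mulrC.
Qed.

Lemma twderM m k a R : (forall r, (R <= r)%N -> twder (m + r%:Z) a = 0) ->
  twder m (x k * a)
  = (m == k)%:R *: a + \sum_(r < R) g r *: (x (k + r%:Z) * twder (m + r%:Z) a).
Proof.
move=> v; have [R0 E] := twderM_large m k a.
rewrite (E (R0 + R)%N) ?leq_addr //; congr (_ + _).
apply: (@sum_trunc _ (fun r => g r *: (x (k + r%:Z) * twder (m + r%:Z) a))).
  by move=> r le; rewrite v ?mulr0 ?scaler0 //; lia.
by move=> r le; rewrite v ?mulr0 ?scaler0.
Qed.

(** The coefficients of g extended by 0 to negative indices. *)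
Definition gz (i : int) : K := if i is Posz r then g r else 0.

(** The identity (1 - q^-2 t^-1) g(t) = q^-2 - t^-1, coefficient by
    coefficient. *)
Lemma gz_taylor i : q != 0 ->
  gz i - q ^- 2 * gz (i + 1) = q ^- 2 * (i == 0)%:R - (i == -1)%:R.
Proof.
move=> q0; case: i => [r|[|r]].
- have := gq_taylor r.+1 q0; rewrite /gz -PoszD addn1 /= => ->.
  by rewrite eqSS.
- by have := gq_taylor 0 q0.
- by rewrite (_ : Negz r.+1 + 1 = Negz r) /gz ?mulr0 //; lia.
Qed.

Variables (N : algType K) (pi : {lrmorphism A -> N}).
Hypothesis pi_relator : forall k l, pi (relator q x k l) = 0.
Local Notation X := (fun i => pi (x i)).

Lemma pi_xM k a : pi (x k * a) = X k * pi a.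
Proof. by rewrite rmorphM. Qed.

Lemma sum_delta_gz (V : lmodType K) m l R (F : int -> V) :
  (forall r : nat, (R <= r)%N -> m + r%:Z != l) ->
  \sum_(r < R) g r *: ((m + r%:Z == l)%:R *: F r%:Z) = gz (l - m) *: F (l - m).
Proof.
move=> neq; case E: (l - m) => [r|r]; last first.
  rewrite scale0r big1 // => i _; rewrite (_ : _ == l = false) ?scale0r ?scaler0 //.
  lia.
have lt : (r < R)%N by rewrite ltnNge; apply/negP => /neq; lia.
rewrite (bigD1 (Ordinal lt)) //= (_ : m + r%:Z == l); last lia.
rewrite scale1r big1 ?addr0 // => i; rewrite -val_eqE /= => ir.
rewrite (_ : _ == l = false) ?scale0r ?scaler0 //; lia.
Qed.

(** The part of D_m (x_k x_l a) in which both letters survive. *)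
Definition twder2_tail m R a k l : N :=
  \sum_(r < R) \sum_(s < R)
    (g r * g s) *: (X (k + r%:Z) * X (l + s%:Z) * pi (twder (m + r%:Z + s%:Z) a)).

(** Removing x_k leaves x_l and removing x_l leaves x_(k+l-m), through the term
    r = l - m of the expansion; the former equals the latter when m = k, so both
    are multiples of the same element. *)
Lemma twder2 m R a k l :
  (forall r : nat, (R <= r)%N -> twder (m + r%:Z) a = 0) ->
  (forall r : nat, (R <= r)%N -> m + r%:Z != l) ->
  pi (twder m (x k * (x l * a)))
  = ((m == k)%:R + gz (l - m)) *: (X (k + l - m) * pi a) + twder2_tail m R a k l.
Proof.
move=> va vl.
have E (r : nat) : twder (m + r%:Z) (x l * a) = (m + r%:Z == l)%:R *: a +
    \sum_(s < R) g s *: (x (l + s%:Z) * twder (m + r%:Z + s%:Z) a).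
  by apply: twderM => s le; rewrite -addrA -PoszD va // (leq_trans le) ?leq_addl.
rewrite (@twderM _ _ _ R); last first.
  move=> r le; rewrite E (negbTE (vl r le)) scale0r add0r big1 // => s _.
  by rewrite -addrA -PoszD va ?mulr0 ?scaler0 // (leq_trans le) ?leq_addr.
rewrite raddfD /= linearZ /= pi_xM scalerDl -addrA; congr (_ + _).
  by case: eqP => [->|_]; rewrite ?scale0r // addrAC subrr add0r.
rewrite raddf_sum /=.
pose F i := X (k + i) * pi a.
rewrite (_ : k + l - m = k + (l - m)); last by rewrite addrA.
rewrite -(@sum_delta_gz _ m l R F) // -big_split; apply: eq_bigr => r _ /=.
rewrite linearZ /= pi_xM E raddfD /= linearZ /= mulrDr scalerDr -scalerAr.
congr (_ + _); rewrite raddf_sum /= mulr_sumr scaler_sumr.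
by apply: eq_bigr => s _; rewrite linearZ /= pi_xM -scalerAr scalerA mulrA.
Qed.

(** Once r and s are exchanged in the two terms with swapped letters, the
    coefficient of g(r) g(s) is the relator of indices k + r and l + s. *)
Lemma twder2_tail_relator m R a k l :
  twder2_tail m R a (k + 1) l - q ^- 2 *: twder2_tail m R a l (k + 1)
  - (q ^- 2 *: twder2_tail m R a k (l + 1) - twder2_tail m R a (l + 1) k) = 0.
Proof.
rewrite [twder2_tail _ _ _ l _]exchange_big [twder2_tail _ _ _ (l + 1) _]exchange_big.
rewrite /= !scaler_sumr -!sumrB big1 // => r _.
rewrite /= !scaler_sumr -!sumrB big1 // => s _.
have := pi_relator (k + r%:Z) (l + s%:Z).
rewrite /relator ![_ + _ + 1]addrAC [m + s%:Z + _]addrAC [g s * _]mulrC.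
rewrite !(rmorphB pi) /= !(linearZ_LR pi) /= !rmorphM => rel0.
set f := pi (twder _ _); set c := g r * g s.
have sw (u : N) : q ^- 2 *: (c *: (u * f)) = c *: (q ^- 2 *: u * f).
  by rewrite -scalerAl !scalerA mulrC.
by rewrite !sw -!scalerBr -!mulrBl rel0 mul0r scaler0.
Qed.

Lemma twder_relator m k l a : q != 0 -> pi (twder m (relator q x k l * a)) = 0.
Proof.
move=> q0; have [R0 v0] := twder_vanish_shift m a.
(* R bounds at once D_(m+r) a and the letters k, l, k + 1 and l + 1. *)
pose R := (R0 + absz m + absz k + absz l + 2)%N.
have v (r : nat) : (R <= r)%N -> twder (m + r%:Z) a = 0 by move=> le; apply: v0; lia.
rewrite /relator !mulrBl -!scalerAl -!mulrA !(linearB (twder m)) !(rmorphB pi).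
rewrite !(linearZ_LR (twder m)) /= !(linearZ_LR pi) /=.
rewrite !(@twder2 _ R) //; try by move=> r; rewrite /R; lia.
have -> : l + (k + 1) - m = k + 1 + l - m by lia.
have -> : k + (l + 1) - m = k + 1 + l - m by lia.
have -> : l + 1 + k - m = k + 1 + l - m by lia.
apply: four_term_comb; last exact: twder2_tail_relator.
have -> : (m == k + 1) = (k - m == -1) by lia.
have -> : (m == l) = (l - m == 0) by lia.
have -> : (m == k) = (k - m == 0) by lia.
have -> : (m == l + 1) = (l - m == -1) by lia.
have -> : k + 1 - m = k - m + 1 by lia.
have -> : l + 1 - m = l - m + 1 by lia.
have -> : gz (l - m) = q ^- 2 * gz (l - m + 1)
    + (q ^- 2 * (l - m == 0)%:R - (l - m == -1)%:R).
  by rewrite -gz_taylor // [RHS]addrC subrK.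
have -> : gz (k - m) = q ^- 2 * gz (k - m + 1)
    + (q ^- 2 * (k - m == 0)%:R - (k - m == -1)%:R).
  by rewrite -gz_taylor // [RHS]addrC subrK.
move: (q ^- 2) => u; ring.
Qed.

(** The statement is strengthened to all right multiples of a, which makes it
    stable under multiplication on the right; stability under multiplication on
    the left is the formula for D_m (x_k a). *)
Lemma twder_ideal a : q != 0 ->
  in_ideal (fun a => exists k l, a = relator q x k l) a ->
  forall m, pi (twder m a) = 0.
Proof.
move=> q0 Ia; suff P : forall c m, pi (a * c) = 0 /\ pi (twder m (a * c)) = 0.
  by move=> m; have [_] := P 1 m; rewrite mulr1.
elim: Ia => {a} [_ [k [l ->]]||a b _ IHa _ IHb|a b _ IHb|a b _ IHa] c m.
- by rewrite twder_relator // (rmorphM pi) /= pi_relator mul0r.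
- by rewrite mul0r !linear0.
- by rewrite mulrDl !linearD /=; case: (IHa c m) (IHb c m) => -> -> [-> ->]; rewrite addr0.
- have pid := proj1 (IHb c m); have Dd m' := proj2 (IHb c m').
  rewrite -mulrA (rmorphM pi) /= pid mulr0; split=> //.
  move: (b * c) Dd pid => d Dd pid {b IHb}.
  move: m; elim/(word_ind freeX): a => [|z s a IHa] m; first by rewrite mul0r !linear0.
  rewrite mulrDl linearD /= linearD /= IHa addr0 -scalerAl !linearZ /= .
  suff -> : pi (twder m (word x s * d)) = 0 by rewrite scaler0.
  move: m {IHa}; elim: s => [|k s IH] m; first by rewrite word_nil mul1r.
  rewrite word_cons -mulrA; have [R v] := twder_vanish_shift m (word x s * d).
  rewrite (@twderM _ _ _ _ v) linearD /= linearZ /= (rmorphM pi) /= pid mulr0 scaler0 add0r.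
  by rewrite raddf_sum /= big1 // => r _; rewrite linearZ /= (rmorphM pi) /= IH mulr0 scaler0.
- by rewrite -mulrA; apply: IHa.
Qed.

End TwistedDerivation.

(** * Operators and forms on an abstract algebra *)

(** The properties that characterise Omega_psi and the form, over any algebra with
    a family X, so that operators obtained by choice and by construction can be
    compared. *)
Record skew_derivations (K : fieldType) (q : K) (N : algType K) (X : int -> N)
    (Om : int -> N -> N) : Prop := {
  skew_linear k : linear (Om k);
  skew1 k : Om k 1 = 0;
  skew_vanish k u :
    exists R : nat, forall r : nat, (R <= r)%N -> Om (k - r%:Z) u = 0;
  skewM k m u (R : nat) :
    (forall r : nat, (R <= r)%N -> Om (k - r%:Z) u = 0) ->
    Om k (X m * u)
    = (k == - m)%:R *: u
      + \sum_(r < R) gq q r *: (X (m + r%:Z) * Om (k - r%:Z) u)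
}.

Record adjoint_form (K : fieldType) (N : algType K) (X : int -> N)
    (Om : int -> N -> N) (B : N -> N -> K) : Prop := {
  form_linearl v : scalar (B^~ v);
  form_linearr u : scalar (B u);
  form_sym u v : B u v = B v u;
  form11 : B 1 1 = 1;
  form_adj m u v : B (X m * u) v = B u (Om (- m) v)
}.

Section SkewDerivations.
Variables (K : fieldType) (q : K) (N : algType K) (X : int -> N).
Variable Om : int -> N -> N.
Hypothesis skewOm : skew_derivations q X Om.
Implicit Types (u v : N) (s : seq int) (k m : int).
Local Notation g := (gq q).

Lemma skew0 k : Om k 0 = 0.
Proof.
have := skew_linear skewOm k (-1) 0 0.
by rewrite scaler0 addr0 scaleN1r addNr.
Qed.

Lemma skew_word_vanish k s : (forall i, i \in s -> i < - k) -> Om k (word X s) = 0.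
Proof.
elim: s k => [|m s IH] k lt; first by rewrite word_nil (skew1 skewOm).
have [R v] := skew_vanish skewOm k (word X s).
have ltm := lt m (mem_head m s).
rewrite word_cons (skewM skewOm _ v) (_ : k == - m = false); last by lia.
rewrite scale0r add0r big1 // => r _; rewrite IH ?mulr0 ?scaler0 // => i si.
have := lt i; rewrite inE si orbT => /(_ isT); lia.
Qed.

Lemma skew_unique Om' :
  (forall P : N -> Prop, P 0 ->
    (forall z s u, P u -> P (z *: word X s + u)) -> forall u, P u) ->
  skew_derivations q X Om' -> forall k u, Om k u = Om' k u.
Proof.
move=> span skewOm' k u; elim/span: u k => [|z s u IH] k.
  rewrite skew0; have := skew_linear skewOm' k (-1) 0 0.
  by rewrite scaler0 addr0 scaleN1r addNr.
rewrite (skew_linear skewOm) (skew_linear skewOm') IH; congr (_ *: _ + _).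
elim: s k {IH u z} => [|m s IH] k.
  by rewrite word_nil (skew1 skewOm) (skew1 skewOm').
have [R v] := skew_vanish skewOm k (word X s).
have v' (r : nat) : (R <= r)%N -> Om' (k - r%:Z) (word X s) = 0.
  by move=> le; rewrite -IH v.
rewrite word_cons (skewM skewOm _ v) (skewM skewOm' _ v').
by congr (_ + _); apply: eq_bigr => r _; rewrite IH.
Qed.

(** * Integrality and triangularity *)

(** Membership in the subring Z[q] of K. *)
Definition int_val (z : K) := exists p : {poly int}, z = (map_poly intr p).[q].

Lemma int_val0 : int_val 0.
Proof. by exists 0; rewrite rmorph0 horner0. Qed.

Lemma int_val1 : int_val 1.
Proof. by exists 1; rewrite rmorph1 hornerC. Qed.

Lemma int_valD z w : int_val z -> int_val w -> int_val (z + w).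
Proof. by move=> [p ->] [r ->]; exists (p + r); rewrite rmorphD hornerD. Qed.

Lemma int_valM z w : int_val z -> int_val w -> int_val (z * w).
Proof. by move=> [p ->] [r ->]; exists (p * r); rewrite rmorphM hornerM. Qed.

Lemma int_val_gq r : int_val (g r).
Proof.
case: r => [|r]; first by exists ('X^2); rewrite map_polyXn hornerXn.
exists (('X^4 - 1) * 'X^(2 * r)).
by rewrite rmorphM rmorphB rmorph1 /= !map_polyXn !hornerE.
Qed.

(** The Z[q]-module spanned by the words of length d. *)
Inductive int_span (d : nat) : N -> Prop :=
| int_span0 : int_span d 0
| int_span_cons z s u :
    int_val z -> size s = d -> int_span d u -> int_span d (z *: word X s + u).

Lemma int_spanD d u v : int_span d u -> int_span d v -> int_span d (u + v).
Proof.
elim=> [|z s {}u iz sz _ IH] iv; first by rewrite add0r.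
by rewrite -addrA; apply: int_span_cons => //; apply: IH.
Qed.

Lemma int_spanZ d z u : int_val z -> int_span d u -> int_span d (z *: u).
Proof.
move=> iz; elim=> [|w s {}u iw sz _ IH]; first by rewrite scaler0; apply: int_span0.
by rewrite scalerDr scalerA; apply: int_span_cons => //; apply: int_valM.
Qed.

Lemma int_span_word s : int_span (size s) (word X s).
Proof.
rewrite -[word X s]scale1r -[_ *: _]addr0.
by apply: int_span_cons => //; [apply: int_val1 | apply: int_span0].
Qed.

Lemma int_spanM d m u : int_span d u -> int_span d.+1 (X m * u).
Proof.
elim=> [|z s {}u iz sz _ IH]; first by rewrite mulr0; apply: int_span0.
rewrite mulrDr -scalerAr -word_cons.
by apply: int_span_cons => //=; rewrite sz.
Qed.

Lemma skew_int_word k s : int_span (size s).-1 (Om k (word X s)).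
Proof.
elim: s k => [|m s IH] k; first by rewrite word_nil (skew1 skewOm); apply: int_span0.
have [R v] := skew_vanish skewOm k (word X s); rewrite word_cons (skewM skewOm _ v).
apply: int_spanD.
  case: eqP => _; rewrite ?scale1r ?scale0r; first exact: int_span_word.
  exact: int_span0.
elim: R {v} => [|R IHR]; first by rewrite big_ord0; apply: int_span0.
rewrite big_ord_recr; apply: int_spanD => //=.
apply: int_spanZ; first exact: int_val_gq.
case: s IH {IHR} => [|m' s] IH /=; last exact/int_spanM/IH.
by rewrite word_nil (skew1 skewOm) mulr0; apply: int_span0.
Qed.

Lemma skew_int_span d k u : int_span d.+1 u -> int_span d (Om k u).
Proof.
elim=> [|z s {}u iz sz _ IH]; first by rewrite skew0; apply: int_span0.
rewrite (skew_linear skewOm); apply: int_spanD IH; apply: int_spanZ => //.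
by have := skew_int_word k s; rewrite sz.
Qed.

Lemma skew_int_span0 k u : int_span 0 u -> Om k u = 0.
Proof.
elim=> [|z s {}u _ /size0nil -> _ IH]; first exact: skew0.
by rewrite (skew_linear skewOm) word_nil (skew1 skewOm) IH scaler0 addr0.
Qed.

Variable B : N -> N -> K.
Hypothesis formB : adjoint_form X Om B.

Lemma form0r u : B u 0 = 0.
Proof.
have := form_linearr formB u (-1) 0 0.
by rewrite scaler0 addr0 mulN1r addNr.
Qed.

(** Each letter moved to the right lowers the length of u by one, until D meets
    the scalars and kills them. *)
Lemma form_shorter_eq0 s d u : int_span d u -> (d < size s)%N -> B (word X s) u = 0.
Proof.
elim: s d u => // k s IH [|d] u iu lt; rewrite word_cons (form_adj formB).
  by rewrite skew_int_span0 ?form0r.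
by apply: (IH d) => //; apply: skew_int_span.
Qed.

Lemma form_int s u : int_span (size s) u -> int_val (B (word X s) u).
Proof.
elim: s u => [|k s IH] u iu; last first.
  by rewrite word_cons (form_adj formB); apply/IH/skew_int_span.
elim: iu => [|z s {}u iz /size0nil -> _ IH]; first by rewrite form0r; apply: int_val0.
rewrite (form_linearr formB) [in X in _ * X]word_nil (form11 formB) mulr1.
exact: int_valD.
Qed.

(** The only term that is not in the induction hypothesis carries the factor
    g(0) = q^2. *)
Lemma form_word_triangular s t : size s = size t -> sorted >=%R s -> sorted >=%R t ->
  exists2 z, int_val z & B (word X s) (word X t) - (s == t)%:R = q ^+ 2 * z.
Proof.
have big_head k m s' t' : m < k -> sorted >=%R (m :: t') ->
    B (word X (k :: s')) (word X (m :: t')) = 0.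
  move=> lt /= /(order_path_min ge_trans)/allP ge_m.
  rewrite word_cons (form_adj formB) skew_word_vanish ?form0r // => i.
  by rewrite opprK inE => /orP[/eqP-> //|/ge_m /= /le_lt_trans]; apply.
elim: s t => [|k s IH] [|m t] //=.
  by exists 0; rewrite ?mulr0 ?word_nil ?(form11 formB) ?subrr //; apply: int_val0.
case=> sz ps pt; case: (ltgtP k m) => [lt|lt|km].
- exists 0; first exact: int_val0.
  rewrite (form_sym formB) big_head // eqseq_cons lt_eqF //= subrr mulr0 //.
- exists 0; first exact: int_val0.
  by rewrite big_head // eqseq_cons gt_eqF //= subrr mulr0.
move: pt; rewrite -km => {m km} pt.
have /allP ge_k := order_path_min ge_trans pt.
(* The letters of t are at most k, so the sum in D_k (x_k t) reduces to r = 0. *)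
have v (r : nat) : (1 <= r)%N -> Om (- k - r%:Z) (word X t) = 0.
  move=> r0; apply: skew_word_vanish => i /ge_k /=; lia.
have [z iz E] := IH t sz (path_sorted ps) (path_sorted pt).
rewrite eqseq_cons eqxx /= !word_cons (form_adj formB) (skewM skewOm _ v) eqxx scale1r.
rewrite big_ord1 /= addr0 subr0 [X in B _ X]addrC (form_linearr formB).
exists (z + B (word X s) (X k * Om (- k) (word X t))).
  apply: int_valD => //; case: t {ge_k v E IH pt} sz => [|m t] sz.
    by rewrite word_nil (skew1 skewOm) mulr0 form0r; apply: int_val0.
  apply: form_int; rewrite sz; apply: int_spanM.
  exact: (skew_int_word _ (m :: t)).
by rewrite mulrDr -E [RHS]addrC addrA.
Qed.

End SkewDerivations.

(** * Descent to the quotient, and the form *)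

Section Form.
Variables (K : fieldType) (q : K) (A : algType K) (x : int -> A).
Hypothesis q_neq0 : q != 0.
Hypothesis freeX : word_basis x.
Variables (N : algType K) (pi : {lrmorphism A -> N}) (rep : N -> A).
Hypothesis repK : cancel rep pi.
Hypothesis kerP : forall a,
  pi a = 0 <-> in_ideal (fun a => exists k l, a = relator q x k l) a.
(* eps is the augmentation; it supplies the pairing with 1. *)
Variable eps : {lrmorphism A -> K^o}.
Hypothesis eps_x : forall k, eps (x k) = 0.
Implicit Types (a b : A) (u v : N) (s : seq int) (k l m : int).
Local Notation g := (gq q).
Local Notation X := (fun i => pi (x i)).
Local Notation D := (twder q freeX).

Lemma pi_relator k l : pi (relator q x k l) = 0.
Proof. by apply/kerP; apply: in_ideal_gen; exists k, l. Qed.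

Lemma pi_twder a b m : pi a = pi b -> pi (D m a) = pi (D m b).
Proof.
move/eqP; rewrite -subr_eq0 -(rmorphB pi) => /eqP/kerP Iab.
apply/eqP; rewrite -subr_eq0 -(rmorphB pi) -linearB.
by apply/eqP; apply: twder_ideal => //; apply: pi_relator.
Qed.

Lemma eps_ker a : pi a = 0 -> eps a = 0.
Proof.
move/kerP; elim=> {a} [_ [k [l ->]]||a b _ a0 _ b0|a b _ b0|a b _ a0].
- by rewrite relator_morph; apply: relator0 => n /=.
- exact: linear0.
- by rewrite linearD /= a0 b0 addr0.
- by rewrite (rmorphM eps) /= b0 mulr0.
- by rewrite (rmorphM eps) /= a0 mul0r.
Qed.

Lemma opprB_shift (k : int) (r : nat) : - (k - r%:Z) = - k + r%:Z.
Proof. by rewrite opprB addrC. Qed.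

(** The sign turns D_m into Omega_psi(-m). *)
Definition quo_twder k u : N := pi (D (- k) (rep u)).

Lemma quo_twder_pi k a : quo_twder k (pi a) = pi (D (- k) a).
Proof. by apply: pi_twder; rewrite repK. Qed.

Lemma quo_twder_linear k : linear (quo_twder k).
Proof.
move=> z u v; rewrite -[u in LHS]repK -[v in LHS]repK -linearP quo_twder_pi.
by rewrite !linearP.
Qed.

Lemma quo_twder1 k : quo_twder k 1 = 0.
Proof. by rewrite -(rmorph1 pi) quo_twder_pi twder1 linear0. Qed.

Lemma quo_twder_vanish k u :
  exists R : nat, forall r : nat, (R <= r)%N -> quo_twder (k - r%:Z) u = 0.
Proof.
have [R v] := twder_vanish_shift q freeX (- k) (rep u); exists R => r le.
by rewrite /quo_twder opprB_shift v // linear0.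
Qed.

Lemma quo_twderM k m u (R : nat) :
  (forall r : nat, (R <= r)%N -> quo_twder (k - r%:Z) u = 0) ->
  quo_twder k (X m * u)
  = (k == - m)%:R *: u
    + \sum_(r < R) g r *: (X (m + r%:Z) * quo_twder (k - r%:Z) u).
Proof.
move=> vR; have [R' v] := twder_vanish_shift q freeX (- k) (rep u).
rewrite -{1}[u]repK -(rmorphM pi) quo_twder_pi (@twderM _ _ _ _ _ _ _ _ _ v).
rewrite linearD /= linearZ /= repK (_ : (- k == m) = (k == - m)); last by lia.
congr (_ + _); rewrite raddf_sum /=.
rewrite (@sum_trunc _ (fun r => g r *: (X (m + r%:Z) * quo_twder (k - r%:Z) u)) R R').
- by apply: eq_bigr => r _; rewrite linearZ /= (rmorphM pi) /quo_twder opprB_shift.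
- by move=> r le; rewrite vR ?mulr0 ?scaler0.
- by move=> r le; rewrite /quo_twder opprB_shift v // linear0 mulr0 scaler0.
Qed.

Lemma quo_twder_skew : skew_derivations q X quo_twder.
Proof.
split; [exact: quo_twder_linear | exact: quo_twder1 | exact: quo_twder_vanish |].
exact: quo_twderM.
Qed.

Fixpoint pair_word s b : K^o :=
  if s is m :: s' then pair_word s' (D m b) else eps b.

Definition pair a b : K := @word_ext _ _ _ freeX K^o (pair_word^~ b) a.

Lemma pair_wordE s b : pair (word x s) b = pair_word s b.
Proof. exact: (@word_extE _ _ _ freeX K^o). Qed.

Lemma pair1 b : pair 1 b = eps b.
Proof. by rewrite -(word_nil x) pair_wordE. Qed.

Lemma pairDl z a a' b : pair (z *: a + a') b = z * pair a b + pair a' b.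
Proof. by rewrite /pair linearP. Qed.

Lemma pair0l b : pair 0 b = 0.
Proof. by rewrite /pair linear0. Qed.

Lemma pair_suml R (F : nat -> K) (G : nat -> A) b :
  pair (\sum_(r < R) F r *: G r) b = \sum_(r < R) F r * pair (G r) b.
Proof.
elim: R => [|R IH]; first by rewrite !big_ord0 pair0l.
by rewrite !big_ord_recr /= addrC pairDl IH addrC.
Qed.

Lemma pair_linearr a : scalar (pair a).
Proof.
move=> z b b'; elim/(word_ind freeX): a => [|c s a IH].
  by rewrite !pair0l mulr0 addr0.
rewrite !pairDl IH !pair_wordE.
suff -> : pair_word s (z *: b + b') = z * pair_word s b + pair_word s b' by ring.
elim: s b b' {IH} => [|m s IH] b b' /=; first by rewrite linearP.
by rewrite linearP IH.
Qed.
HB.instance Definition _ a :=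
  GRing.isLinear.Build K A K *%R (pair a) (pair_linearr a).

Lemma pairM m a b : pair (x m * a) b = pair a (D m b).
Proof.
elim/(word_ind freeX): a => [|c s a IH]; first by rewrite mulr0 !pair0l.
by rewrite mulrDr -scalerAr -word_cons !pairDl IH !pair_wordE.
Qed.

(** Both sides expand, for a = x_m a', into
    [m = k] (a', b) + sum_r g(r) (D_(k+r) a', D_(m+r) b): a symmetric expression,
    reached on either side by one use of the induction hypothesis. *)
Lemma pair_mulr k a b : pair a (x k * b) = pair (D k a) b.
Proof.
elim/(word_ind freeX): a k b => [|c s a IHa] k b.
  by rewrite !linear0 !pair0l.
rewrite linearP !pairDl IHa; congr (_ * _ + _) => {IHa c a}.
elim: s k b => [|m s IH] k b.
  by rewrite word_nil twder1 pair1 pair0l (rmorphM eps) /= eps_x mul0r.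
rewrite word_cons pairM.
have [R vb] := twder_vanish_shift q freeX m b.
have [R' vs] := twder_vanish_shift q freeX k (word x s).
rewrite (@twderM _ _ _ _ _ m k b (R + R')); last first.
  by move=> r le; apply: vb; apply: leq_trans le; apply: leq_addr.
rewrite (@twderM _ _ _ _ _ k m _ (R + R')); last first.
  by move=> r le; apply: vs; apply: leq_trans le; apply: leq_addl.
rewrite linearP pairDl eq_sym; congr (_ + _).
rewrite linear_sum (pair_suml _ g (fun r => x (m + r%:Z) * D (k + r%:Z) _)).
by apply: eq_bigr => r _; rewrite linearZ /= IH pairM.
Qed.

(** The letters of b are moved to the left one at a time, by pair_mulr on one side
    and pairM on the other. *)
Lemma pair_sym a b : pair a b = pair b a.
Proof.
elim/(word_ind freeX): b a => [|c s b IHb] a; first by rewrite linear0 pair0l.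
rewrite linearP pairDl /= IHb; congr (_ * _ + _) => {IHb c b}.
elim: s a => [|m s IH] a; last by rewrite word_cons pair_mulr pairM IH.
rewrite word_nil pair1.
elim/(word_ind freeX): a => [|c s a IHa]; first by rewrite pair0l linear0.
rewrite pairDl IHa linearP; congr (_ * _ + _).
case: s => [|m s]; first by rewrite word_nil pair1.
by rewrite word_cons pairM twder1 linear0 (rmorphM eps) /= eps_x mul0r.
Qed.

Lemma pair_ker a b b' : pi b = pi b' -> pair a b = pair a b'.
Proof.
elim/(word_ind freeX): a => [|c s a IHa] bb; first by rewrite !pair0l.
rewrite !pairDl IHa // !pair_wordE; congr (_ * _ + _) => {IHa c a}.
elim: s b b' bb => [|m s IH] b b' bb /=; last exact/IH/pi_twder.
apply/eqP; rewrite -subr_eq0 -(linearB eps); apply/eqP/eps_ker.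
by rewrite (rmorphB pi) /= bb subrr.
Qed.

Definition quo_pair u v := pair (rep u) (rep v).

Lemma quo_pair_pi a b : quo_pair (pi a) (pi b) = pair a b.
Proof.
rewrite /quo_pair (pair_ker _ (repK (pi b))) pair_sym.
by rewrite (pair_ker _ (repK (pi a))) pair_sym.
Qed.

Lemma quo_pair_sym u v : quo_pair u v = quo_pair v u.
Proof. exact: pair_sym. Qed.

Lemma quo_pair_linearr u : scalar (quo_pair u).
Proof.
move=> z v w; rewrite -[u]repK -[v in LHS]repK -[w in LHS]repK -linearP.
by rewrite quo_pair_pi linearP /quo_pair repK.
Qed.

Lemma quo_pair_linearl v : scalar (quo_pair^~ v).
Proof. by move=> z u w; rewrite !(quo_pair_sym _ v) quo_pair_linearr. Qed.

Lemma quo_pair11 : quo_pair 1 1 = 1.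
Proof. by rewrite -(rmorph1 pi) quo_pair_pi pair1 rmorph1. Qed.

Lemma quo_pair_adj m u v : quo_pair (X m * u) v = quo_pair u (quo_twder (- m) v).
Proof.
rewrite -[u]repK -[v]repK -(rmorphM pi) quo_pair_pi pairM quo_twder_pi opprK.
by rewrite quo_pair_pi.
Qed.

Lemma quo_pair_adjoint : adjoint_form X quo_twder quo_pair.
Proof.
split; [exact: quo_pair_linearl | exact: quo_pair_linearr | exact: quo_pair_sym
       | exact: quo_pair11 | exact: quo_pair_adj].
Qed.

End Form.

(** * The operators and the form of the algebra *)

Section NqForm.
Variables (K : fieldType) (q : K).
Hypothesis q_neq0 : q != 0.

(** The maps of the construction, retyped with their morphism structures. *)
Definition pi_Nq : {lrmorphism freeA K -> Nq q} := piQ (@Nq_proper K q).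
Definition rep_Nq : Nq q -> freeA K := @reprQ _ _ _ (@Nq_proper K q).
Definition eps_freeA : {lrmorphism freeA K -> K^o} := @freeA_coef1 K.

Lemma rep_NqK : cancel rep_Nq pi_Nq.
Proof. exact: reprQK. Qed.

Lemma pi_Nq_kerP (a : freeA K) :
  pi_Nq a = 0 <-> in_ideal (fun a => exists k l, a = relator q (freex K) k l) a.
Proof.
by rewrite -(raddf0 (piQ (@Nq_proper K q))) -{2}[a]subr0; apply: piQ_eqP.
Qed.

Lemma Nq_ind (P : Nq q -> Prop) :
  P 0 -> (forall z s u, P u -> P (z *: word (xm q) s + u)) -> forall u, P u.
Proof.
move=> P0 PD u; rewrite -(rep_NqK u).
elim/(@free_ind K): (rep_Nq u) => [|z s a]; first by rewrite linear0.
by move/(PD z s); rewrite linearP /= rmorph_prod.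
Qed.

Definition Nq_twder := quo_twder q (freeA_word_basis K) pi_Nq rep_Nq.

Lemma Nq_twder_skew : skew_derivations q (xm q) Nq_twder.
Proof. exact: (quo_twder_skew q_neq0 _ rep_NqK pi_Nq_kerP). Qed.

Lemma Omega_psi_skew : skew_derivations q (xm q) (@Omega_psi K q).
Proof.
have [] : is_Omega_psi (@Omega_psi K q); last by split.
by apply: epsilon_spec; exists Nq_twder; case: Nq_twder_skew; split.
Qed.

(** The form constructed above is adjoint to Nq_twder, which is Omega_psi by
    uniqueness. *)
Lemma Nq_form_adjoint : adjoint_form (xm q) (@Omega_psi K q) (@Nq_form K q).
Proof.
have eps_x k : eps_freeA (freex K k) = 0 by exact: freeA_coef1_freex.
have [] : is_Nq_form (@Nq_form K q); last by split.
apply: epsilon_spec; exists (quo_pair q (freeA_word_basis K) rep_Nq eps_freeA).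
have [Bl Br Bs B1 adj] :=
  quo_pair_adjoint q_neq0 (freeA_word_basis K) rep_NqK pi_Nq_kerP eps_x.
split=> // m a b; rewrite (skew_unique Omega_psi_skew Nq_ind Nq_twder_skew).
exact: adj.
Qed.

End NqForm.

(** * Expansions at q = 0 *)

Section Expansion.
Variable F : fieldType.

Lemma horner_qq (p : {poly int}) :
  (map_poly intr p).[qq F] = poly_in_q (map_poly intr p : {poly F}).
Proof.
elim/poly_ind: p => [|p c IH]; first by rewrite !rmorph0 horner0 /poly_in_q !rmorph0.
rewrite !rmorphD !rmorphM /= !map_polyX !map_polyC /= !hornerE IH /poly_in_q.
rewrite comp_polyD comp_polyM comp_polyX comp_polyC !rmorphD !rmorphM /=.
by rewrite -mulrA /qhalf !rmorph_int.
Qed.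

(** A polynomial in q is its own expansion, with denominator 1. *)
Lemma in_q2Zq_horner (z : Kq F) : int_val (qq F) z -> in_q2Zq (qq F ^+ 2 * z).
Proof.
move=> [p ->]; exists (fun i => ('X^2 * p)`_i); rewrite !coefXnM; split=> //.
exists (map_poly intr ('X^2 * p)), 1; split.
- by rewrite coef1 oner_eq0.
- rewrite -horner_qq rmorphM /= map_polyXn hornerM hornerXn.
  by rewrite /poly_in_q !rmorph1 divr1.
move=> i; rewrite big_ord_recr /= subnn coef1 mulr1 big1 ?add0r ?coef_map //.
by move=> j _; rewrite coef1 subn_eq0 leqNgt ltn_ord mulr0.
Qed.

End Expansion.

Theorem proposition4p0p2 (F : fieldType) (charF : [pchar F] =i pred0)
    (n l : nat) (m : n.-tuple int) (k : l.-tuple int) :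
  [/\ (l < n)%N -> Nq_form (xmon (qq F) m) (xmon (qq F) k) = 0,
      n = l ->
        sorted >=%R m -> sorted >=%R k ->
        \sum_(i <- m) i = \sum_(i <- k) i ->
        in_q2Zq (Nq_form (xmon (qq F) m) (xmon (qq F) k) - (m == k :> seq int)%:R)
    & forall a b : Nq (qq F), Nq_form a b = Nq_form b a].
Proof.
have skew := Omega_psi_skew (qq_neq0 F).
have adj := Nq_form_adjoint (qq_neq0 F); split; last exact: form_sym adj.
  move=> lt; apply: (form_shorter_eq0 skew adj (int_span_word _ _ k)).
  by rewrite !size_tuple.
move=> nl sm sk _; have [|z iz E] := form_word_triangular skew adj _ sm sk.
  by rewrite !size_tuple.
by rewrite [_ - _]E; apply: in_q2Zq_horner.
Qed.
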